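(* Let $n \ge 2$ and let $B_n = (k_1+1, k_2+1, \ldots, k_n+1)$ be a bouquet of $n$ circles with a cut-vertex. Then $\dim(L(B_n)) = 2n-1$.
   Context: All graphs are finite, simple, undirected and connected. For integers $k_n \ge k_{n-1} \ge \cdots \ge k_1 \ge 2$, the bouquet $B_n = (k_1+1, \ldots, k_n+1)$ is the graph obtained from $n$ cycles $C^1, \ldots, C^n$, where $C^i$ has $k_i+1$ vertices, by identifying one vertex from each cycle into a single common vertex $v$ (so the cycles pairwise share only $v$). For a graph $H$, a set $W \subseteq V(H)$ is a resolving set if for every pair of distinct vertices $u,w$ there is $x \in W$ with $d(u,x) \ne d(w,x)$ ($d$ the shortest-path distance); $\dim(H)$ is the minimum cardinality of a resolving set. $L(G)$ is the line graph of $G$ (vertices are the edges of $G$, adjacent iff they share an endpoint). *)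

(* Defs.v *)
From mathcomp Require Import all_boot.

Set Implicit Arguments.
Unset Strict Implicit.
Unset Printing Implicit Defensive.

(* A finite simple graph is a symmetric irreflexive relation e on a finType T. *)

Section Graphs.
Variables (T : finType) (e : rel T).

(* y is reachable from x by a walk with exactly n edges. *)
Definition walk (n : nat) (x y : T) : bool :=
  [exists p : n.-tuple T, path e x p && (last x p == y)].

(* A shortest walk has fewer than #|T| edges, so on a connected graph this is
   the shortest-path distance; the value is #|T| if y is unreachable from x. *)
Definition dist (x y : T) : nat :=
  find (fun n => walk n x y) (iota 0 #|T|).

Definition resolving (W : {set T}) : bool :=
  [forall u, forall w, (u != w) ==> [exists x in W, dist u x != dist w x]].

(* The default setT of the arg min is always resolving: see resolving_setT. *)
Definition metric_dim : nat :=
  #|[arg min_(W < [set: T] | resolving W) #|W|]|.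

Definition edges : {set {set T}} :=
  [set [set p.1; p.2] | p in [set p : T * T | e p.1 p.2]].

Definition edge : finType := {E : {set T} | E \in edges}.

Definition line_graph : rel edge :=
  fun E F => (E != F) && (val E :&: val F != set0).

End Graphs.

Arguments line_graph {T} e _ _.

(* For m >= 3 this is the cycle on m vertices; ordS is the cyclic successor. *)
Definition cycle_graph (m : nat) : rel 'I_m :=
  fun a b => (b == ordS a) || (a == ordS b).

Section Bouquet.
Variables (n : nat) (k : 'I_n -> nat).

(* None is the common vertex v; Some (i, j) is the j-th of the k i other
   vertices of the i-th cycle. *)
Definition bouquet_vertex : finType := option {i : 'I_n & 'I_(k i)}.

(* The map from the i-th cycle to the bouquet that identifies vertex 0 with v. *)
Definition bouquet_in (i : 'I_n) (a : 'I_(k i).+1) : bouquet_vertex :=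
  omap (Tagged (fun i => 'I_(k i))) (unlift ord0 a).

Definition bouquet : rel bouquet_vertex :=
  fun x y => [exists i : 'I_n, exists a : 'I_(k i).+1, exists b : 'I_(k i).+1,
    [&& cycle_graph a b, bouquet_in a == x & bouquet_in b == y]].

End Bouquet.

Arguments bouquet {n} k _ _.

Lemma resolving_setT (T : finType) (e : rel T) : resolving e [set: T].
Proof.
have d0 u x : (dist e u x == 0) = (u == x).
  have T0 : 0 < #|T| by apply/card_gt0P; exists u.
  rewrite /dist; case: #|T| T0 => //= m _.
  have -> : walk e 0 u x = (u == x).
    apply/existsP/idP => [[p]|ux]; first by rewrite (tuple0 p).
    by exists [tuple].
  by case: (u == x).
apply/forallP=> u; apply/forallP=> w; apply/implyP=> uw.
apply/existsP; exists u; rewrite inE /=.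
have /eqP -> : dist e u u == 0 by rewrite d0.
by rewrite eq_sym d0 eq_sym.
Qed.

Lemma cycle_graph_irrefl (m : nat) : 2 <= m -> irreflexive (@cycle_graph m.+1).
Proof.
move=> m2 a; rewrite /cycle_graph orbb; apply/negP=> /eqP /(congr1 val) /=.
case: (ltngtP a m) (ltn_ord a) => [am _|ma|am _].
- by rewrite modn_small // => /n_Sn.
- by rewrite ltnS leqNgt ma.
by rewrite am modnn => m0; rewrite m0 in m2.
Qed.

Lemma bouquet_in_inj (n : nat) (k : 'I_n -> nat) (i : 'I_n) :
  injective (@bouquet_in n k i).
Proof.
move=> a b; rewrite /bouquet_in.
case: (unliftP ord0 a) => [a' ->|->]; case: (unliftP ord0 b) => [b' ->|->] //=.
by case=> /eqP; rewrite eq_Tagged => /eqP /= ->.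
Qed.

Lemma bouquet_sym (n : nat) (k : 'I_n -> nat) : symmetric (bouquet k).
Proof.
suff H x y : bouquet k x y -> bouquet k y x.
  by move=> x y; apply/idP/idP; apply: H.
move=> /existsP[i /existsP[a /existsP[b /and3P[ab ax bx]]]].
apply/existsP; exists i; apply/existsP; exists b; apply/existsP; exists a.
by rewrite ax bx /cycle_graph orbC; move: ab; rewrite /cycle_graph => ->.
Qed.

Lemma bouquet_irrefl (n : nat) (k : 'I_n -> nat) :
  (forall i, 2 <= k i) -> irreflexive (bouquet k).
Proof.
move=> k2 x; case Hxx: (bouquet k x x) => //.
have /existsP[i /existsP[a /existsP[b /and3P[ab ax bx]]]] := Hxx.
move: bx; rewrite -(eqP ax) => /eqP/bouquet_in_inj ba.
by rewrite ba cycle_graph_irrefl in ab.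
Qed.

(* Main.v *)
(* In the line graph, two edges of one cycle are at their cyclic distance, and
   two edges of different cycles are at distance 1 + the sum of their depths,
   the depth being the distance to the nearest edge at the cut-vertex.
   Lower bound: only a landmark on a cycle separates the two edges of that cycle
   at the cut-vertex, so each cycle has a landmark; if two cycles had just one
   each, then the farther of the two edges at the cut-vertex, taken on both
   cycles, would give two edges at distance 1 + depth from every landmark.
   Upper bound: both edges at the cut-vertex on all cycles but one, and one such
   edge on the last cycle, form a resolving set. *)
Require Import Defs.
From mathcomp Require Import all_boot.
From mathcomp Require Import zify.

Set Implicit Arguments.
Unset Strict Implicit.
Unset Printing Implicit Defensive.

(** * Recognising the distance of a graph from local properties of a function *)

Section Distance.
Variables (T : finType) (e : rel T).

Lemma metric_dim_eq (W0 : {set T}) (m : nat) :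
    resolving e W0 -> #|W0| <= m ->
    (forall W, resolving e W -> m <= #|W|) ->
  metric_dim e = m.
Proof.
move=> resW0 leW0 lbW; rewrite /metric_dim.
case: arg_minnP => [|W resW minW]; first exact: resolving_setT.
by apply/eqP; rewrite eqn_leq lbW // (leq_trans (minW _ resW0)).
Qed.

Variables (P : finType) (f : P -> T) (D : P -> P -> nat).
Hypothesis bij_f : bijective f.
Hypothesis D_refl : forall p, D p p = 0.
Hypothesis D_eq0 : forall p q, D p q = 0 -> p = q.
Hypothesis D_lip : forall p p' q, e (f p) (f p') -> D p q <= (D p' q).+1.
Hypothesis D_step : forall p q m, D p q = m.+1 ->
  exists2 p', e (f p) (f p') & D p' q = m.

Lemma leq_walk s p q : walk e s (f p) (f q) -> D p q <= s.
Proof.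
case: bij_f => g fK gK; elim: s p => [|s IHs] p /existsP[t /andP[]].
  by rewrite (tuple0 t) /= => _ /eqP/(can_inj fK)->; rewrite D_refl.
case/tupleP: t => x t /= /andP[epx pt] lt.
rewrite -[x]gK in epx pt lt.
apply: leq_trans (D_lip q epx) _; rewrite ltnS; apply: IHs.
by apply/existsP; exists t; rewrite pt lt.
Qed.

Lemma walk_dist p q : walk e (D p q) (f p) (f q).
Proof.
move: {2}(D p q) (erefl (D p q)) => m; elim: m p => [|m IHm] p Dp.
  rewrite Dp (D_eq0 Dp); apply/existsP; exists [tuple] => /=.
  exact: eqxx.
have [p' epp' Dp'] := D_step Dp; rewrite Dp.
have := IHm _ Dp'; rewrite Dp' => /existsP[t /andP[pt lt]].
by apply/existsP; exists [tuple of f p' :: t]; rewrite /= epp' pt lt.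
Qed.

(** Descending from [p] by [D_step], the balls around [q] grow strictly with each unit of radius.
    This puts every value of [D] inside the range that [dist] searches. *)
Lemma ltn_dist_card p q : D p q < #|T|.
Proof.
have -> : #|T| = #|P| by rewrite (bij_eq_card bij_f).
suff : D p q < #|[set r | D r q <= D p q]|.
  by move=> /leq_trans; apply; apply: max_card.
move: {2}(D p q) (erefl (D p q)) => m; elim: m p => [|m IHm] p Dp.
  by rewrite Dp card_gt0; apply/set0Pn; exists p; rewrite inE Dp.
have [p' _ Dp'] := D_step Dp.
have := IHm _ Dp'; rewrite Dp' Dp => /leq_ltn_trans; apply.
apply: proper_card; apply/properP; split.
  by apply/subsetP => r; rewrite !inE => /leqW.
by exists p; rewrite !inE Dp ?ltnn.
Qed.

(** [D_lip] bounds the length of every walk from below by [D], and [D_step] builds a walk of exactly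
    that length. *)
Lemma dist_eq p q : dist e (f p) (f q) = D p q.
Proof.
rewrite /dist; set a := fun s => _; have ltDT := ltn_dist_card p q.
have ha : has a (iota 0 #|T|).
  by apply/hasP; exists (D p q); [rewrite mem_iota | exact: walk_dist].
have lt_find : find a (iota 0 #|T|) < #|T|.
  by move: ha; rewrite has_find size_iota.
apply/eqP; rewrite eqn_leq; apply/andP; split; last first.
  by have := nth_find 0 ha; rewrite nth_iota // => /leq_walk.
rewrite leqNgt; apply/negP => /(before_find 0).
by rewrite nth_iota // /a add0n walk_dist.
Qed.

Lemma resolvingP (W : {set T}) :
  reflect (forall p q, p != q -> exists2 w, f w \in W & D p w != D q w)
          (resolving e W).
Proof.
apply: (iffP forallP) => [res p q npq|res u]; case: bij_f => g fK gK.
  have /forallP/(_ (f q))/implyP := res (f p).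
  rewrite (can_eq fK) => /(_ npq)/existsP[x /andP[xW]].
  by rewrite -[x]gK !dist_eq => ne; exists (g x); rewrite ?gK.
apply/forallP => w; apply/implyP; rewrite -[u]gK -[w]gK (can_eq fK).
move=> /res[x xW ne]; apply/existsP; exists (f x).
by rewrite xW !dist_eq.
Qed.

End Distance.

(** * The line graph of the bouquet and its distance in coordinates *)

Section LineGraph.
Variables (n : nat) (k : 'I_n -> nat).
Hypothesis k_ge2 : forall i, 2 <= k i.

(* [Tagged _ a] over [i] stands for the edge of the i-th cycle that joins its
   vertices a and a + 1 modulo k i + 1; the edges at the cut-vertex are those
   with a = 0 and a = k i. *)
Let pos : finType := {i : 'I_n & 'I_(k i).+1}.
Let mkpos i (a : 'I_(k i).+1) : pos := Tagged (fun i => 'I_(k i).+1) a.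

Definition depth (p : pos) : nat :=
  minn (tagged p) (k (tag p) - tagged p).

(** Cyclic distance on [m.+1] points; with truncated subtraction, [(a - b) + (b - a)] is the
    absolute difference. *)
Definition cdist (m a b : nat) : nat :=
  minn ((a - b) + (b - a)) (m.+1 - ((a - b) + (b - a))).

Definition line_dist (p q : pos) : nat :=
  if tag p == tag q then cdist (k (tag p)) (tagged p) (tagged q)
  else (depth p + depth q).+1.

Lemma val_ordS m (a : 'I_m.+1) :
  ordS a = (if a == m :> nat then 0 else a.+1) :> nat.
Proof.
rewrite /=; case: eqP => [->|/eqP am]; first by rewrite modnn.
by rewrite modn_small //; have := ltn_ord a; lia.
Qed.

Lemma bouquet_in_eq i j (a : 'I_(k i).+1) (b : 'I_(k j).+1) :
  (bouquet_in a == bouquet_in b) =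
  (a == b :> nat) && ((i == j) || (a == 0 :> nat)).
Proof.
have [eij|nij] := eqVneq i j.
  by subst j; rewrite andbT (inj_eq (@bouquet_in_inj _ k i)).
rewrite /bouquet_in.
case: (unliftP ord0 a) => [a' ->|->]; case: (unliftP ord0 b) => [b' ->|->] //=.
  rewrite andbF; apply/eqP => -[eij _].
  by rewrite eij eqxx in nij.
Qed.

Definition edge_set (p : pos) : {set bouquet_vertex k} :=
  [set bouquet_in (tagged p); bouquet_in (ordS (tagged p))].

Lemma edge_set_edges p : edge_set p \in edges (bouquet k).
Proof.
apply/imsetP; exists (bouquet_in (tagged p), bouquet_in (ordS (tagged p))) => //.
rewrite inE; apply/existsP; exists (tag p); apply/existsP; exists (tagged p).
by apply/existsP; exists (ordS (tagged p)); rewrite /cycle_graph !eqxx.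
Qed.

Definition edge_of (p : pos) : edge (bouquet k) :=
  Sub (edge_set p) (edge_set_edges p).

Lemma edge_of_surj E : exists p, edge_of p = E.
Proof.
have /imsetP[[x y]] := valP E.
rewrite inE /= => /existsP[i /existsP[a /existsP[b /and3P[ab /eqP<- /eqP<-]]]] defE.
case/orP: ab => /eqP eab; [exists (mkpos a) | exists (mkpos b)];
  apply/val_inj/(etrans _ (esym defE)); rewrite /= /edge_set /= -eab //.
exact: setUC.
Qed.

Lemma pos_eq i (a b : 'I_(k i).+1) : a = b :> nat -> mkpos a = mkpos b.
Proof. by move/val_inj->. Qed.

(** This rests on [k_ge2]: on a cycle with two vertices, positions 0 and 1 would have the same
    endpoints. *)
Lemma edge_of_inj : injective edge_of.
Proof.
move=> [i a] [j b] /(congr1 val)/= /setP eE.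
have := eE (bouquet_in a); have := eE (bouquet_in (ordS a)).
have := eE (bouquet_in b).
rewrite !inE !bouquet_in_eq !val_ordS !eqxx /=.
have := ltn_ord a; have := ltn_ord b; have := k_ge2 i; have := k_ge2 j.
have [ak|ak] := eqVneq (nat_of_ord a) (k i);
have [bk|bk] := eqVneq (nat_of_ord b) (k j);
(have [eij|nij] := eqVneq i j;
  [by subst j; clear eE => *; apply: pos_eq; lia | by clear eE => /=; lia]).
Qed.

Lemma edge_of_bij : bijective edge_of.
Proof.
apply: (inj_card_bij edge_of_inj).
rewrite -(card_codom edge_of_inj); apply: subset_leq_card; apply/subsetP => E _.
by have [p <-] := edge_of_surj E; apply: codom_f.
Qed.

(** Two edges meet iff one of four pairs of endpoints coincides. On different cycles this can only
    happen at the cut-vertex, that is, when both depths are 0. *)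
Lemma line_graphE p q :
  line_graph (bouquet k) (edge_of p) (edge_of q) = (line_dist p q == 1).
Proof.
rewrite /line_graph (inj_eq edge_of_inj).
have -> : (val (edge_of p) :&: val (edge_of q) != set0) =
   [|| bouquet_in (tagged p) == bouquet_in (tagged q),
       bouquet_in (tagged p) == bouquet_in (ordS (tagged q)),
       bouquet_in (ordS (tagged p)) == bouquet_in (tagged q) |
       bouquet_in (ordS (tagged p)) == bouquet_in (ordS (tagged q))].
  apply/set0Pn/idP => [[x]|].
    by rewrite !inE => /andP[/orP[]/eqP->] /orP[]->; rewrite ?orbT.
  case/or4P => /eqP eq_pq;
    [exists (bouquet_in (tagged p)) | exists (bouquet_in (tagged p))
    | exists (bouquet_in (ordS (tagged p))) | exists (bouquet_in (ordS (tagged p)))];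
    by rewrite !inE eq_pq eqxx ?orbT.
rewrite !bouquet_in_eq !val_ordS.
move: p q => [i a] [j b]; rewrite /line_dist /depth /cdist /=.
have := ltn_ord a; have := ltn_ord b; have := k_ge2 i; have := k_ge2 j.
have [eij|nij] := eqVneq i j.
  subst j; rewrite eq_Tagged /= -val_eqE /=.
  by have [ak|ak] := eqVneq (nat_of_ord a) (k i);
    have [bk|bk] := eqVneq (nat_of_ord b) (k i); lia.
have -> : (existT (fun i => 'I_(k i).+1) i a == existT _ j b) = false.
  by apply/eqP => /(congr1 tag)/= eij; rewrite eij eqxx in nij.
by have [ak|ak] := eqVneq (nat_of_ord a) (k i);
  have [bk|bk] := eqVneq (nat_of_ord b) (k j); lia.
Qed.

Lemma line_dist_refl p : line_dist p p = 0.
Proof. by rewrite /line_dist eqxx /cdist; lia. Qed.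

Lemma line_dist_eq0 p q : line_dist p q = 0 -> p = q.
Proof.
move: p q => [i a] [j b]; rewrite /line_dist /cdist /=.
case: eqVneq => // eij; subst j => /= H; apply: pos_eq.
by have := ltn_ord a; have := ltn_ord b; lia.
Qed.

Lemma line_dist_lip p p' q :
  line_dist p p' = 1 -> line_dist p q <= (line_dist p' q).+1.
Proof.
move: p p' q => [i a] [j b] [l c]; rewrite /line_dist /cdist /depth /=.
have := ltn_ord a; have := ltn_ord b; have := ltn_ord c.
case: (eqVneq i j) => [eij|nij].
  by subst j; case: (eqVneq i l) => [eil|_]; [subst l; lia | lia].
case: (eqVneq j l) => [ejl|_]; first by subst l; rewrite (negPf nij); lia.
by case: (eqVneq i l) => [eil|_]; [subst l; lia | lia].
Qed.

(** On one cycle, the step follows the shorter arc, wrapping between positions 0 and [k i] if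
    necessary. Otherwise it decreases the depth of [p], and from depth 0 it jumps to the end of the
    other cycle that is nearer to [q]. *)
Lemma line_dist_step p q m : line_dist p q = m.+1 ->
  exists2 p', line_dist p p' = 1 & line_dist p' q = m.
Proof.
move: p q => [i a] [j b]; have := k_ge2 i; have := k_ge2 j.
have := ltn_ord a; have := ltn_ord b.
case: (eqVneq i j) => [eij|nij] ltb lta kj ki H.
  subst j.
  suff [c [ltc c1 c2]] : exists c, [/\ c < (k i).+1, cdist (k i) a c = 1
      & cdist (k i) c b = m].
    by exists (mkpos (Ordinal ltc)); rewrite /line_dist /= eqxx.
  move: H; rewrite /line_dist /= eqxx /cdist => H.
  have [ab|ab] := leqP a b.
    have [s|s] := leqP (b - a) ((k i).+1 - (b - a)).
      by exists a.+1; split; lia.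
    exists (if a == 0 :> nat then k i else a.-1).
    by case: (eqVneq (nat_of_ord a) 0) => a0; split; lia.
  have [s|s] := leqP (a - b) ((k i).+1 - (a - b)).
    by exists a.-1; split; lia.
  exists (if a == k i :> nat then 0 else a.+1).
  by case: (eqVneq (nat_of_ord a) (k i)) => a0; split; lia.
move: H; rewrite {1}/line_dist /= (negPf nij) /depth /= => H.
have [d0|dpos] := posnP (minn a (k i - a)).
  suff [c [ltc c1 c2]] : exists c, [/\ c < (k j).+1, minn c (k j - c) = 0
      & cdist (k j) c b = m].
    exists (mkpos (Ordinal ltc)); rewrite /line_dist /= ?eqxx ?(negPf nij) //.
    by rewrite /depth /= c1 d0.
  rewrite /cdist; have [s|s] := leqP b (k j - b).
    by exists 0; split; lia.
  by exists (k j); split; lia.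
suff [c [ltc c1 c2]] : exists c, [/\ c < (k i).+1, cdist (k i) a c = 1
    & (minn c (k i - c)).+1 = minn a (k i - a)].
  exists (mkpos (Ordinal ltc)); rewrite /line_dist /= ?eqxx ?(negPf nij) //.
  by rewrite /depth /=; lia.
rewrite /cdist; have [s|s] := leqP a (k i - a).
  by exists a.-1; split; lia.
by exists a.+1; split; lia.
Qed.

Lemma line_resolvingP (W : {set edge (bouquet k)}) :
  reflect (forall p q, p != q ->
             exists2 w, edge_of w \in W & line_dist p w != line_dist q w)
          (resolving (line_graph (bouquet k)) W).
Proof.
apply: (@resolvingP _ _ _ edge_of line_dist).
- exact: edge_of_bij.
- exact: line_dist_refl.
- exact: line_dist_eq0.
- move=> p p' q.
  by rewrite line_graphE => /eqP/line_dist_lip.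
by move=> p q m /line_dist_step[p' pp' p'q]; exists p'; rewrite // line_graphE pp'.
Qed.

Definition first_pos i : pos := mkpos (@ord0 (k i)).
Definition last_pos i : pos := mkpos (@ord_max (k i)).

Lemma first_neq_last i : first_pos i != last_pos i.
Proof. by rewrite eq_Tagged /= -val_eqE /=; have := k_ge2 i; lia. Qed.

(** * Lower bound: counting landmarks cycle by cycle *)

Section LowerBound.
Variable W : {set edge (bouquet k)}.
Hypothesis resW : resolving (line_graph (bouquet k)) W.

Let Wi i := [set p : pos | (edge_of p \in W) && (tag p == i)].

Lemma line_dist_endpoints i p : tag p != i ->
  line_dist (first_pos i) p = (depth p).+1 /\
  line_dist (last_pos i) p = (depth p).+1.
Proof. by rewrite /line_dist /depth /= eq_sym => /negPf->; lia. Qed.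

Lemma cycle_landmark i : exists2 w, w \in Wi i &
  line_dist (first_pos i) w != line_dist (last_pos i) w.
Proof.
have /line_resolvingP/(_ _ _ (first_neq_last i))[w wW ne] := resW.
exists w => //; rewrite inE wW /=; apply: contraR ne => /line_dist_endpoints[-> ->].
by rewrite eqxx.
Qed.

(* With a single landmark on the i-th cycle, the edge at the cut-vertex on the
   far side of it is seen by every landmark as if it lay on another cycle. *)
Lemma invisible_edge i : #|Wi i| <= 1 ->
  exists2 p, tag p = i & forall w, edge_of w \in W -> line_dist p w = (depth w).+1.
Proof.
move=> /card_le1_eqP leW1; have [[j a] aWi ne] := cycle_landmark i.
have eji : j = i by move: aWi; rewrite inE => /andP[_ /eqP].
subst j.
have lta := ltn_ord a; have ki := k_ge2 i.
(* In the tie [a = k i - a] both edges would be at distance [a] from the landmark, which [ne]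
   excludes. *)
exists (if a < k i - a then last_pos i else first_pos i); first by case: ifP.
move=> w wW; have [wi|nwi] := eqVneq (tag w) i; last first.
  by have [e1 e2] := line_dist_endpoints nwi; case: ifP.
have -> : w = mkpos a by apply: leW1 => //; rewrite inE wW wi /=.
move: ne; rewrite /line_dist /depth /cdist /= eqxx.
by case: ltnP => s /=; rewrite eqxx /=; lia.
Qed.

Lemma card_resolving : 2 * n - 1 <= #|W|.
Proof.
have -> : #|W| = \sum_i #|Wi i|.
  rewrite -(on_card_preimset (onW_bij _ edge_of_bij)) -sum1_card.
  rewrite (partition_big (@tag _ _) xpredT) //=.
  by apply: eq_bigr => i _; rewrite -sum1_card; apply: eq_bigl => p; rewrite !inE.
(* Either every cycle carries two landmarks, or some cycle [i] carries just one and every other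
   cycle at least two. *)
case: (pickP (fun i => #|Wi i| <= 1)) => [i Wi1|Wi2]; last first.
  have : \sum_(i < n) 2 <= \sum_i #|Wi i|.
    by apply: leq_sum => i _; rewrite ltnNge Wi2.
  by rewrite sum_nat_const card_ord; lia.
rewrite (bigD1 i) //=.
have Wi0 : 0 < #|Wi i|.
  by have [w wWi _] := cycle_landmark i; apply/card_gt0P; exists w.
have : \sum_(j | j != i) 2 <= \sum_(j | j != i) #|Wi j|.
  apply: leq_sum => j nji; rewrite ltnNge; apply/negP => Wj1.
  have [p pi Hp] := invisible_edge Wi1; have [q qj Hq] := invisible_edge Wj1.
  have npq : p != q by apply: contraNneq nji => epq; rewrite -pi -qj epq.
  have /line_resolvingP/(_ _ _ npq)[w wW] := resW.
  by rewrite Hp // Hq // eqxx.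
rewrite sum_nat_const (cardC1 i) card_ord => le2W.
by apply: leq_trans (leq_add Wi0 le2W); lia.
Qed.

End LowerBound.

(** * Upper bound: an explicit resolving set *)

Definition landmarks (i0 : 'I_n) : {set pos} :=
  [set first_pos i | i in 'I_n] :|: [set last_pos i | i in predC1 i0].

Lemma card_landmarks i0 : #|edge_of @: landmarks i0| <= 2 * n - 1.
Proof.
apply: leq_trans (leq_imset_card _ _) _; apply: leq_trans (leq_card_setU _ _) _.
apply: leq_trans (leq_add (leq_imset_card _ _) (leq_imset_card _ _)) _.
by rewrite cardC1 card_ord; have := ltn_ord i0; lia.
Qed.

(* Equal distances to both first edges force equal depths, and both edges then
   look as if they lay on the other cycle; but an edge of depth d is at distance
   d from one end of its own cycle. *)
Lemma separate_cycles p q : tag p != tag q ->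
    line_dist p (first_pos (tag p)) = line_dist q (first_pos (tag p)) ->
    line_dist p (first_pos (tag q)) = line_dist q (first_pos (tag q)) ->
  line_dist p (last_pos (tag p)) != line_dist q (last_pos (tag p)).
Proof.
move: p q => [i a] [j b] /= nij.
rewrite /line_dist /depth /cdist /= !eqxx [j == i]eq_sym (negPf nij) /=.
have lta := ltn_ord a; have ltb := ltn_ord b.
rewrite !subn0 !sub0n !min0n subnn minn0 !addn0.
move=> eq_i eq_j.
have -> : minn b (k j - b) = minn a (k i - a) by lia.
by move: eq_i eq_j; lia.
Qed.

Lemma landmarks_resolving i0 : 2 <= n ->
  resolving (line_graph (bouquet k)) (edge_of @: landmarks i0).
Proof.
move=> n2; apply/line_resolvingP => p q npq.
suff [w wL ne] : exists2 w, w \in landmarks i0 & line_dist p w != line_dist q w.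
  by exists w => //; rewrite imset_f.
have [/existsP[w /andP[]]|/existsPn same] :=
  boolP [exists w, (w \in landmarks i0) && (line_dist p w != line_dist q w)].
  by exists w.
have {}same w : w \in landmarks i0 -> line_dist p w = line_dist q w.
  by move=> wL; have := same w; rewrite wL /= negbK => /eqP.
have same0 i : line_dist p (first_pos i) = line_dist q (first_pos i).
  by apply: same; rewrite inE imset_f.
have samek i : i != i0 -> line_dist p (last_pos i) = line_dist q (last_pos i).
  by move=> ni; apply: same; rewrite inE orbC imset_f.
case/eqP: npq.
move: p q same0 samek {same} => [i a] [j b] same0 samek.
have [eij|nij] := eqVneq i j.
  subst j; apply: pos_eq.
  (* The first edge of another cycle [l] detects the depth, so [a] and [b] are equal or mirror
     images; the first edge of cycle [i] tells distinct mirror images apart. *)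
  have [l nli] : exists l : 'I_n, l != i.
    have : 0 < #|predC1 i| by rewrite cardC1 card_ord; lia.
    by case/card_gt0P => l; exists l.
  have := same0 l; have := same0 i; have := ltn_ord a; have := ltn_ord b.
  by rewrite /line_dist /depth /cdist /= eqxx eq_sym (negPf nli); lia.
(* Only [i0] lacks its last edge as a landmark, so one of the two cycles has both, and
   [separate_cycles] applies with that cycle in the first place. *)
have : (i != i0) || (j != i0).
  by apply: contraR nij; rewrite negb_or !negbK => /andP[/eqP-> /eqP->].
case/orP => [/samek eq_k|/samek/esym eq_k].
  have /(_ nij (same0 i) (same0 j)) := @separate_cycles (mkpos a) (mkpos b).
  by rewrite eq_k eqxx.
rewrite eq_sym in nij.
have := @separate_cycles (mkpos b) (mkpos a) nij (esym (same0 j)) (esym (same0 i)).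
by rewrite eq_k eqxx.
Qed.

End LineGraph.

Theorem theorem2p13 (n : nat) (k : 'I_n -> nat)
    (hn : 2 <= n)
    (hk2 : forall i : 'I_n, 2 <= k i)
    (hk : forall i j : 'I_n, i <= j -> k i <= k j) :
  metric_dim (line_graph (bouquet k)) = 2 * n - 1.
Proof.
(* Any cycle may serve as the one with a single landmark. *)
have i0 : 'I_n by case: n hn {k hk2 hk} => // m _; exact: ord0.
apply: metric_dim_eq (landmarks_resolving hk2 i0 hn) (card_landmarks _ _) _.
by move=> W; apply: card_resolving.
Qed.
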